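(* Let $m\ge0$. The cover relations $\lessdot$ of the poset $\Sigma_m$ of sashes of length $m$ are exactly the following (where $A$, $B$ are sashes, possibly of length $0$, with total length making both sides of length $m$): (1) $A\,\mathsf b\,B\lessdot A\,\mathsf w\,B$ for any sash $A$ and any sash $B$ whose leftmost tile is not a white square; (2) $A\,\mathsf b\mathsf w\,B\lessdot A\,\mathsf r\,B$ for any sash $A$ and any sash $B$; (3) $A\,\mathsf r\,B\lessdot A\,\mathsf w\mathsf w\,B$ for any sash $A$ and any sash $B$.
   Context: A sash of length $m\ge 0$ is a tiling of a $1\times m$ rectangle by black $1\times1$ squares ($\mathsf b$), white $1\times1$ squares ($\mathsf w$) and white $1\times2$ rectangles ($\mathsf r$, occupying two positions); it is written as a word in $\mathsf b,\mathsf w,\mathsf r$ from left to right, juxtaposition is concatenation, and there is a single sash of length $0$ (empty word). $\Sigma_m$ is the set of sashes of length $m$. $S_n$ is the set of permutations of $[n]=\{1,\dots,n\}$ with the weak order: $x\le x'$ iff every inversion of $x$ is an inversion of $x'$, an inversion of $x=x_1\cdots x_n$ being a pair of values $(x_i,x_j)$ with $i<j$, $x_i>x_j$. A Pell permutation is $x\in S_n$ such that $x_i-x_{i+1}\le 2$ for all $i$, and whenever $x_i=x_{i+1}+2$ the value $x_{i+1}+1$ appears to the right of $x_{i+1}$; $P_n$ is the set of Pell permutations in $S_n$ with the partial order induced by the weak order (it is a lattice). The map $\sigma:S_n\to\Sigma_{n-1}$: position $i$ ($1\le i\le n-1$) of $\sigma(x)$ is a black square if $i+1$ is to the right of $i$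 in $x$, and a white square if $i+1$ is to the left of $i$, except that if $i+1$ is to the right of $i$ and $i+2$ is to the left of $i$ then a rectangle occupies positions $i$ and $i+1$. The restriction of $\sigma$ to $P_n$ is a bijection $P_n\to\Sigma_{n-1}$. The partial order on $\Sigma_{n-1}$ is the one making $\sigma:P_n\to\Sigma_{n-1}$ an order isomorphism. *)

(* Defs.v *)
From mathcomp Require Import all_boot all_fingroup.

Set Implicit Arguments.
Unset Strict Implicit.
Unset Printing Implicit Defensive.

(* Permutations are 0-based: x : 'S_n sends a position to the value at that
   position (the one-line notation of x is x 0, x 1, ...), so the value k here
   is the value k + 1 of {1, ..., n}. *)

(* Inversions are pairs of values, not of positions. *)
Definition inversions n (x : 'S_n) : {set 'I_n * 'I_n} :=
  [set p | [exists i : 'I_n, exists j : 'I_n,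
              [&& i < j, x j < x i & p == (x i, x j)]]].

Definition weak_le n (x y : 'S_n) : bool := inversions x \subset inversions y.

Definition pell n (x : 'S_n) : bool :=
  [forall i : 'I_n, forall j : 'I_n, (j == i.+1 :> nat) ==>
    ((x i <= x j + 2) &&
     ((x i == x j + 2 :> nat) ==>
        [exists k : 'I_n, (j < k) && (x k == (x j).+1 :> nat)]))].

Inductive tile : Type := Black | White | Rect.

Definition tile_len (t : tile) : nat := if t is Rect then 2 else 1.

Definition sash_len (s : seq tile) : nat := \sum_(t <- s) tile_len t.

(* A word of arbitrary length is a sash of some length; sash m is Sigma_m. *)
Definition sash (m : nat) : Type := {s : seq tile | sash_len s == m}.

(* The value l is strictly to the left of the value k in x. *)
Definition left_of m (x : 'S_m.+1) (l k : nat) : bool :=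
  (x^-1%g (inord l : 'I_m.+1) < x^-1%g (inord k : 'I_m.+1))%N.

(* The part of sigma(x) filling the last d positions, the first of which
   compares the values i and i + 1 (only used with i + d = m, so that all the
   values passed to inord are at most m). *)
Fixpoint sigma_from m (x : 'S_m.+1) (d i : nat) : seq tile :=
  match d with
  | 0 => [::]
  | d1.+1 =>
    if left_of x i.+1 i then White :: sigma_from x d1 i.+1
    else match d1 with
         | 0 => [:: Black]
         | d2.+1 => if left_of x i.+2 i then Rect :: sigma_from x d2 i.+2
                    else Black :: sigma_from x d1 i.+1
         end
  end.

Lemma sigma_from_len m (x : 'S_m.+1) d i : sash_len (sigma_from x d i) == d.
Proof.
suff: sash_len (sigma_from x d i) = d /\
      (forall i, sash_len (sigma_from x d.+1 i) = d.+1) by case=> ->.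
have lenC t s : sash_len (t :: s) = tile_len t + sash_len s.
  by rewrite /sash_len big_cons.
have len0 : sash_len [::] = 0 by rewrite /sash_len big_nil.
elim: d i => [|d IH] i.
  by split=> // j; rewrite /=; case: ifP; rewrite lenC len0.
have [_ IHS] := IH i; split=> [|j]; first exact: IHS.
have IHd k : sash_len (sigma_from x d k) = d by have [] := IH k.
have -> : sigma_from x d.+2 j =
    if left_of x j.+1 j then White :: sigma_from x d.+1 j.+1
    else if left_of x j.+2 j then Rect :: sigma_from x d j.+2
    else Black :: sigma_from x d.+1 j.+1 by [].
by case: ifP => _; [|case: ifP => _]; rewrite lenC ?IHS ?IHd.
Qed.

Definition sigma m (x : 'S_m.+1) : sash m :=
  exist _ (sigma_from x m 0) (sigma_from_len x m 0).

(* The order transported from the Pell permutations along sigma. Since sigma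
   restricts to a bijection from the Pell permutations to sash m, it is the only
   order for which that restriction is an isomorphism. *)
Definition sash_le m (s t : sash m) : Prop :=
  exists x y : 'S_m.+1,
    [/\ pell x, pell y, sigma x = s, sigma y = t & weak_le x y].

Definition sash_lt m (s t : sash m) : Prop := sash_le s t /\ s <> t.

Definition sash_cover m (s t : sash m) : Prop :=
  sash_lt s t /\ ~ exists u : sash m, sash_lt s u /\ sash_lt u t.

(* Main.v *)
Require Import Defs.
From mathcomp Require Import all_boot all_fingroup.
From mathcomp Require Import zify.

(** Spell a sash as a word over the chain 0 < 1 < 2, one letter per unit of
    length: a black square is 0, a white square is 2, a rectangle is 1 2. The
    words obtained are exactly those in which every 1 is followed by a 2, and
    the order on sashes becomes the componentwise order on these words
    ([sash_leP]).

    For this, read off the letters on a permutation x: position i carries 2 if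
    i+1 is left of i, otherwise 1 if i+2 is left of i, otherwise 0. These
    letters only depend on the inversions between values at distance 1 and 2,
    and enlarging the inversion set increases them. Conversely, in a Pell
    permutation every inversion is a consequence, by transitivity, of
    inversions at distance 1 and 2: the entries of x go down by at most 2, so
    on the way from a value b to a smaller value on its right, the first entry
    below b is b-1 or b-2 ([pell_drop]). Hence the letters of a Pell
    permutation determine the weak order ([weak_le_letter]). Every sash comes
    from some Pell permutation, built by inserting the values in increasing
    order ([pell_exists]).

    The covers are then found on words. If u < v, let i be the last position
    where they differ. The letter of u at i can be raised, to the next letter
    if it is followed by a 2 and from 0 to 2 otherwise, giving a legal word
    that is still at most v ([code_le_step]). The possible raises are the three
    families of the theorem. In each of them a single letter changes, and no
    legal word fits strictly between: the only candidate, a 1 between a 0 and a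
    2, would need a following 2, which is what the condition on B in the first
    family excludes ([step_cover]). *)

(** * Sashes as words over a three-element chain *)

Definition tile_code (t : tile) : seq nat :=
  match t with Black => [:: 0] | White => [:: 2] | Rect => [:: 1; 2] end.

Definition code (s : seq tile) : seq nat := flatten (map tile_code s).

Definition code_le (s t : seq tile) : bool := all2 leq (code s) (code t).

Lemma code_cons c s : code (c :: s) = tile_code c ++ code s.
Proof. by []. Qed.

Lemma code_cat s t : code (s ++ t) = code s ++ code t.
Proof. by rewrite /code map_cat flatten_cat. Qed.

Lemma sash_len_cons c s : sash_len (c :: s) = tile_len c + sash_len s.
Proof. by rewrite /sash_len big_cons. Qed.

Lemma size_code s : size (code s) = sash_len s.
Proof.
elim: s => [|c s IH]; first by rewrite /sash_len big_nil.
by rewrite code_cons size_cat IH sash_len_cons; case: c.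
Qed.

(** Tiles have codes starting with distinct letters, so decoding is forced. *)
Lemma code_inj : injective code.
Proof.
by elim=> [|[] s IH] [|[] t] //; rewrite !code_cons => -[] /IH ->.
Qed.

(** The only legality condition on codes: a 1 is always the first half of a
    rectangle. *)
Lemma code_after1 s l r : code s = l ++ 1 :: r -> exists r', r = 2 :: r'.
Proof.
elim: s l => [|c s IH] l; first by case: l.
case: c; rewrite code_cons; case: l => [|a l] //=.
- by case=> _ /IH.
- by case=> _ /IH.
- by case=> <-; exists (code s).
- by case: l => [|b l] //= [] _ _ /IH.
Qed.

Lemma code_head2 s r : code s = 2 :: r -> ohead s = Some White.
Proof. by case: s => [|[]]. Qed.

Lemma all2_leq_refl l : all2 leq l l.
Proof. by elim: l => //= a l ->; rewrite leqnn. Qed.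

Lemma all2_leq_anti l z : all2 leq l z -> all2 leq z l -> z = l.
Proof.
elim: l z => [|a l IH] [|b z] //= /andP[ab lz] /andP[ba zl].
by rewrite (IH z) //; congr (_ :: _); lia.
Qed.

Lemma all2_leq_between l f g r z :
  all2 leq (l ++ f :: r) z -> all2 leq z (l ++ g :: r) ->
  exists2 c, z = l ++ c :: r & f <= c <= g.
Proof.
elim: l z => [|a l IH] [|b z] //= /andP[ab lz] /andP[ba zl].
  by exists b; rewrite ?ab // (all2_leq_anti _ _ lz zl).
by have [c -> cP] := IH z lz zl; exists c => //; congr (_ :: _); lia.
Qed.

(** * Raising one letter *)

Definition step (s t : seq tile) : Prop :=
  exists A B : seq tile,
     [\/ [/\ s = A ++ Black :: B, t = A ++ White :: B
           & ohead B <> Some White],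
         s = A ++ [:: Black, White & B] /\ t = A ++ Rect :: B
       | s = A ++ Rect :: B /\ t = A ++ [:: White, White & B]].

Lemma step_cons c s t : step s t -> step (c :: s) (c :: t).
Proof.
case=> A [B] H; exists (c :: A), B.
case: H => [[-> -> nW]|[-> ->]|[-> ->]];
  by [constructor 1 | constructor 2 | constructor 3].
Qed.

(** The words are peeled from the left for as long as the tails still differ,
    so that the raise happens at the last difference: there the first letter
    of the common tail tells which raise is legal. When a black square meets a
    rectangle, the second half of the rectangle stays in the tail as a white
    square, having the same letter 2; when a rectangle meets a white square,
    its second letter forces a second white square, which is peeled too. *)
Lemma code_le_step s t :
  code_le s t -> s = t \/ exists2 u, step s u & code_le u t.
Proof.
have pre c u v : (u = v \/ exists2 w, step u w & code_le w v) ->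
    c :: u = c :: v \/ exists2 w, step (c :: u) w & code_le w (c :: v).
  case=> [->|[w uw wv]]; [by left|right].
  exists (c :: w); first exact: step_cons.
  by rewrite /code_le !code_cons; case: (c) => /=; exact: wv.
elim: s t => [|c s IH] t; first by case: t => [|[]]; [left | | |].
case: c; case: t => [|[] t] //=.
- by move=> st; apply/pre/IH.
- move=> st; right; have [->|[u su ut]] := IH t st.
    case: t {st} => [|[] t].
    + exists [:: White]; last exact: all2_leq_refl.
      by exists [::], [::]; constructor 1.
    + exists [:: White, Black & t]; last exact: all2_leq_refl.
      by exists [::], (Black :: t); constructor 1.
    + exists (Rect :: t); last by rewrite /code_le /= all2_leq_refl.
      by exists [::], t; constructor 2.
    + exists [:: White, Rect & t]; last exact: all2_leq_refl.
      by exists [::], (Rect :: t); constructor 1.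
  by exists (Black :: u) => //; apply: step_cons.
- move=> st; right; have [->|[u su ut]] := IH (White :: t) st.
    exists (Rect :: t); last exact: all2_leq_refl.
    by exists [::], t; constructor 2.
  by exists (Black :: u) => //; apply: step_cons.
- by move=> st; apply/pre/IH.
- case: t => [|[] t] //= st; right; have [->|[u su ut]] := IH t st.
    exists [:: White, White & t]; last exact: all2_leq_refl.
    by exists [::], t; constructor 3.
  by exists (Rect :: u) => //; apply: step_cons.
- by move=> st; apply/pre/IH.
Qed.

(** Uniform shape of the three families: one letter is raised from f to g, and
    legality of codes rules out the letters strictly between. *)
Lemma step_code s t : step s t -> exists l f g r,
  [/\ code s = l ++ f :: r, code t = l ++ g :: r, f < g
    & forall u c, code u = l ++ c :: r -> f <= c <= g -> c = f \/ c = g].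
Proof.
case=> A [B] [[-> -> nW]|[-> ->]|[-> ->]]; exists (code A).
- exists 0, 2, (code B); rewrite !code_cat; split=> // u [|[|[|c]]] //; auto.
  (* A 1 in this place would make B start with a white square. *)
  by move=> /code_after1[r /code_head2].
- exists 0, 1, (2 :: code B); rewrite !code_cat; split=> // u c _; lia.
- exists 1, 2, (2 :: code B); rewrite !code_cat; split=> // u c _; lia.
Qed.

Lemma step_lt s t : step s t -> code_le s t /\ s <> t.
Proof.
case/step_code=> l [f] [g] [r] [sE tE fg _]; split.
  rewrite /code_le sE tE; elim: l {sE tE} => [|a l IH] /=.
    by rewrite ltnW //= all2_leq_refl.
  by rewrite leqnn.
move=> st; move: tE; rewrite -st sE => /eqP; rewrite eqseq_cat // eqxx /=.
by case/eqP => fgE; rewrite fgE ltnn in fg.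
Qed.

Lemma step_cover s t u :
  step s t -> code_le s u -> code_le u t -> u = s \/ u = t.
Proof.
case/step_code=> l [f] [g] [r] [sE tE _ fgP] su ut.
rewrite /code_le sE in su; rewrite /code_le tE in ut.
have [c uE cP] := all2_leq_between _ _ _ _ _ su ut.
by have [cE|cE] := fgP u c uE cP; [left|right]; apply: code_inj;
   rewrite uE cE.
Qed.

(** * The letters of a permutation *)

Definition letter {m} (x : 'S_m.+1) (i : nat) : nat :=
  if left_of x i.+1 i then 2
  else if (i.+2 <= m) && left_of x i.+2 i then 1 else 0.

(** A rectangle at i yields the letters 1 2: if i+1 is not left of i but i+2 is,
    then i+2 is left of i+1, so the letter at i+1 is indeed 2. *)
Lemma code_sigma_from m (x : 'S_m.+1) d i :
  i + d = m -> code (sigma_from x d i) = map (letter x) (iota i d).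
Proof.
elim/ltn_ind: d i => -[|[|d]] // IH i im.
  rewrite /= /letter; case: ifP => // _.
  by rewrite (_ : (i.+2 <= m) = false) //; lia.
have -> : sigma_from x d.+2 i =
    if left_of x i.+1 i then White :: sigma_from x d.+1 i.+1
    else if left_of x i.+2 i then Rect :: sigma_from x d i.+2
    else Black :: sigma_from x d.+1 i.+1 by [].
have -> : map (letter x) (iota i d.+2)
    = letter x i :: map (letter x) (iota i.+1 d.+1) by [].
have i2m : i.+2 <= m by lia.
rewrite {1}/letter i2m; case: ifPn => [_|nii].
  by rewrite code_cons IH //; lia.
case: ifPn => ii2; last by rewrite code_cons IH //; lia.
rewrite code_cons IH //; last lia.
rewrite /= {2}/letter ifT //.
by move: nii ii2; rewrite /left_of; lia.
Qed.

Lemma code_sigma m (x : 'S_m.+1) : code (sval (sigma x)) = mkseq (letter x) m.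
Proof. by rewrite /= code_sigma_from. Qed.

Lemma left_of_ord m (x : 'S_m.+1) (i j : 'I_m.+1) :
  left_of x (x i) (x j) = (i < j).
Proof. by rewrite /left_of !inord_val !permK. Qed.

Lemma left_of_trans m (x : 'S_m.+1) b a c :
  left_of x a b -> left_of x b c -> left_of x a c.
Proof. exact: ltn_trans. Qed.

Lemma left_of_total m (x : 'S_m.+1) a b :
  a <= m -> b <= m -> [|| a == b, left_of x a b | left_of x b a].
Proof.
move=> am bm; rewrite /left_of.
case: (ltngtP (x^-1%g _) _) => //; rewrite ?orbT //.
move/val_inj/perm_inj/(congr1 (@nat_of_ord _)).
by rewrite !inordK // => ->; rewrite eqxx.
Qed.

Lemma weak_leP m (x y : 'S_m.+1) :
  reflect (forall a b, a < b <= m -> left_of x b a -> left_of y b a)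
          (weak_le x y).
Proof.
have invE (z : 'S_m.+1) (p : 'I_m.+1 * 'I_m.+1) :
    (p \in inversions z) = (p.2 < p.1) && left_of z p.1 p.2.
  rewrite inE; apply/existsP/andP => [[i /existsP[j /and3P[ij ji /eqP->]]]|].
    by rewrite left_of_ord.
  case: p => b a /= [ab zba]; exists (z^-1%g b); apply/existsP; exists (z^-1%g a).
  by rewrite -(left_of_ord _ z) !permKV ab eqxx zba.
apply: (iffP subsetP) => [sub a b /andP[ab bm] xba|H [b a]].
  have := sub (inord b, inord a); rewrite !invE /= /left_of !inord_val !inordK; try lia.
  by rewrite ab => /(_ xba).
rewrite !invE /= => /andP[ab xba]; rewrite ab /= H //.
by rewrite ab /= -ltnS.
Qed.

(** * Inversions of Pell permutations *)

(** Walk in x from the value b to the smaller value a on its right, and let v be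
    the first entry below b. The entry just before v is at least b and exceeds
    v by at most 2, so v is b-1, or else v is b-2 and is preceded by b itself;
    in the latter case the Pell condition puts b-1 further to the right. *)
Lemma pell_drop m (x : 'S_m.+1) a b :
  pell x -> a < b <= m -> left_of x b a ->
  left_of x b b.-1 /\
  exists v, [/\ v < b <= v + 2, left_of x b v & v = a \/ left_of x v a].
Proof.
move=> px /andP[ab bm] xba.
pose p := x^-1%g (inord b); pose q := x^-1%g (inord a).
have xp : x p = b :> nat by rewrite permKV inordK.
have xq : x q = a :> nat by rewrite permKV inordK //; lia.
pose P j := (p < j) && (x (inord j) < b).
have exP : exists j, P j.
  by exists q; rewrite /P inord_val xq ab andbT.
case: (ex_minnP exP) => j /andP[pj xj] jmin.
have jq : j <= q by apply: jmin; rewrite /P inord_val xq ab andbT.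
have jm : j < m.+1 by apply: leq_ltn_trans jq _.
have pjE : inord j.-1 = j.-1 :> nat := inordK (_ : j.-1 < m.+1).
move: (forallP px (inord j.-1)) => /forallP/(_ (inord j)).
rewrite pjE ?inordK //; try lia.
rewrite (_ : j == j.-1.+1) /=; last lia.
have xj1 : b <= x (inord j.-1).
  have [E|ne] := eqVneq (p : nat) j.-1; first by rewrite -E inord_val xp.
  rewrite leqNgt; apply/negP => lt; have := jmin j.-1.
  by rewrite /P lt andbT; lia.
case/andP=> le2 eq2.
have bj : left_of x b (x (inord j)) by rewrite -xp left_of_ord inordK.
split; last first.
  exists (x (inord j)); split=> //; first by lia.
  have [E|ne] := eqVneq (q : nat) j.
    by left; rewrite -E inord_val.
  by right; rewrite -xq left_of_ord inordK //; lia.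
have [E|ne] := eqVneq (x (inord j) : nat) b.-1; first by rewrite -E.
move/implyP: eq2 => /(_ _) /existsP[|k /andP[jk /eqP xk]]; first lia.
by rewrite (_ : b.-1 = x k) -?xp ?left_of_ord; lia.
Qed.

(** The backward direction is by induction on b, an inversion (b, a) of x being
    split as (b, v) and (v, a) with v as in [pell_drop]. *)
Lemma weak_le_letter m (x y : 'S_m.+1) : pell x ->
  reflect (forall i, i < m -> letter x i <= letter y i) (weak_le x y).
Proof.
move=> px; apply: (iffP (weak_leP _ x y)) => [H i im|H].
  rewrite /letter; case: ifPn => [xi|_].
    by rewrite (H i i.+1) //; lia.
  case: ifPn => // /andP[i2 xi].
  by rewrite i2 (H i i.+2) //; [case: ifP | lia].
have one b : 0 < b <= m -> left_of x b b.-1 -> left_of y b b.-1.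
  case: b => // b bm xb; move: (H b bm); rewrite /letter xb.
  by case: ifP => //; case: ifP.
move=> a b; elim/ltn_ind: b => b IH abm xba.
have [xb [v [vb xbv va]]] := pell_drop _ _ _ _ px abm xba.
have yb : left_of y b b.-1 by apply: one => //; lia.
have [->//|na] := eqVneq a b.-1.
have ybv : left_of y b v.
  (* For v = b-2 the letter of y at v is 1 or 2. If it is 1, the inversion is
     there directly; if it is 2, b-1 is left of v in y, and b is left of b-1. *)
  have [->//|ne] := eqVneq v b.-1.
  have bE : b = v.+2 by lia.
  rewrite {}bE in xbv xb yb abm *.
  have v2m : v.+2 <= m by lia.
  have : 0 < letter y v.
    by apply: leq_trans (H v _); [rewrite /letter xbv v2m; case: ifP | lia].
  rewrite /letter; case: ifP => [yv _|_]; first exact: left_of_trans yb yv.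
  by rewrite v2m /=; case: ifP.
have [<-//|nv] := eqVneq v a.
case: va => [E|xva]; first by rewrite E eqxx in nv.
by apply: left_of_trans ybv (IH v _ _ xva); lia.
Qed.

(** * Every sash comes from a Pell permutation *)

Definition insert_max {m} (x : 'S_m.+1) (j : 'I_m.+2) : 'S_m.+2 :=
  lift_perm j ord_max x.

Lemma left_of_insert_old m (x : 'S_m.+1) j a b :
  a <= m -> b <= m -> left_of (insert_max x j) a b = left_of x a b.
Proof.
have E k : k <= m -> inord k = lift ord_max (inord k : 'I_m.+1) :> 'I_m.+2.
  by move=> km; apply: ord_inj; rewrite lift_max !inordK //; lia.
move=> am bm; rewrite /left_of !E // lift_permV !lift_perm_lift /= /bump; lia.
Qed.

Lemma left_of_insert_max m (x : 'S_m.+1) (j : 'I_m.+2) b :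
  b <= m -> left_of (insert_max x j) m.+1 b = (j <= x^-1%g (inord b)).
Proof.
move=> bm; rewrite /left_of lift_permV.
have -> : inord m.+1 = ord_max :> 'I_m.+2 by apply: ord_inj; rewrite inordK.
have -> : inord b = lift ord_max (inord b : 'I_m.+1) :> 'I_m.+2.
  by apply: ord_inj; rewrite lift_max !inordK //; lia.
rewrite lift_perm_id lift_perm_lift /= /bump; lia.
Qed.

(** Inserting the maximum creates a single new descent, from the maximum to the
    entry it is put in front of: this has to be m, or m-1 with m on its right.
    At the end of the word there is no such entry and the hypothesis is
    void. *)
Lemma pell_insert_max m (x : 'S_m.+1) (j : 'I_m.+2) : pell x ->
  (forall k : 'I_m.+1, k = j :> nat ->
     x k = m :> nat \/ (x k).+1 = m :> nat /\ left_of x m.-1 m) ->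
  pell (insert_max x j).
Proof.
move=> px jP; apply/forallP => i1; apply/forallP => i2; apply/implyP => /eqP.
have lm k : insert_max x j (lift j k) = x k :> nat.
  by rewrite lift_perm_lift lift_max.
have jm : insert_max x j j = m.+1 :> nat by rewrite lift_perm_id.
have lk k : x k < m.+1 by [].
case: (unliftP j i1) => [k1|] ->; case: (unliftP j i2) => [k2|] ->;
  rewrite ?lm ?jm.
- move: k1 k2 => /= k1 k2; rewrite /bump => k12.
  have {}k12 : k2 == k1.+1 :> nat by lia.
  move: (forallP (forallP px k1) k2); rewrite k12 /= => /andP[-> /=].
  move=> /implyP H; apply/implyP=> /H /existsP[k /andP[kk /eqP xk]].
  by apply/existsP; exists (lift j k); rewrite lm xk eqxx /= /bump; lia.
- move: k1 => /= k1 _; have xk1 := lk k1.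
  have -> : (x k1 == m.+1 + 2 :> nat) = false by lia.
  by rewrite implyFb andbT; lia.
- move: k2 => /= k2; rewrite /bump => k2E; have /jP : k2 = j :> nat by lia.
  case=> [xk|[xk lft]].
    have -> : (m.+1 == x k2 + 2 :> nat) = false by lia.
    by rewrite implyFb andbT; lia.
  rewrite (_ : _ <= _) /=; last lia.
  apply/implyP => _; apply/existsP; exists (lift j (x^-1%g (inord m))).
  rewrite lm permKV inordK // xk eqxx andbT /=.
  have k2V : k2 = x^-1%g (inord m.-1).
    by apply: (canRL (permK x)); apply: ord_inj; rewrite inordK; lia.
  by move: lft; rewrite /left_of -k2V /bump; lia.
- by move/eqP; rewrite ltn_eqF.
Qed.

Lemma letter_insert_max m (x : 'S_m.+1) j i : i.+1 < m ->
  letter (insert_max x j) i = letter x i.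
Proof.
move=> im; rewrite /letter !left_of_insert_old; try lia.
by rewrite im leqW.
Qed.

Lemma code_rcons s c : code (rcons s c) = code s ++ tile_code c.
Proof. by rewrite -cats1 code_cat /code /= cats0. Qed.

Lemma sash_len_rcons s c : sash_len (rcons s c) = sash_len s + tile_len c.
Proof. by rewrite -size_code code_rcons size_cat size_code; case: c. Qed.

Lemma mkseq_insert_max m (x : 'S_m.+1) j :
  (0 < m -> letter (insert_max x j) m.-1 = letter x m.-1) ->
  mkseq (letter (insert_max x j)) m.+1 =
  rcons (mkseq (letter x) m) (letter (insert_max x j) m).
Proof.
move=> H; rewrite mkseqS; congr rcons; apply/eq_in_map => i.
rewrite mem_iota => im; have [E|ne] := eqVneq i m.-1.
  by rewrite E H //; lia.
by rewrite letter_insert_max //; lia.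
Qed.

(** Induction on the length, removing the last tile. A new maximum goes to the
    end for a black square, just before m for a white one. A rectangle of
    letters 1 2 is obtained from a black square in place of its first half:
    then m is right of m-1, and the new maximum goes just before m-1, which
    turns the letter 0 into 1 and adds the letter 2. *)
Lemma pell_exists m (s : seq tile) :
  sash_len s = m -> exists2 x : 'S_m.+1, pell x & code s = mkseq (letter x) m.
Proof.
elim: m s => [|m IH] s.
  case: s => [|c s]; last by rewrite sash_len_cons; case: c.
  move=> _; exists 1%g => //; apply/forallP => i; apply/forallP => j.
  by rewrite !ord1.
case/lastP: s => [|s c]; first by rewrite /sash_len big_nil.
rewrite sash_len_rcons code_rcons => sm.
have last_letter (x : 'S_m.+1) j : letter (insert_max x j) m =
    if j <= x^-1%g (inord m) then 2 else 0.
  by rewrite /letter left_of_insert_max // ltnn.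
have prev_letter (x : 'S_m.+1) j : 0 < m ->
    letter (insert_max x j) m.-1 = if left_of x m m.-1 then 2
      else if j <= x^-1%g (inord m.-1) then 1 else 0.
  move=> m0; rewrite /letter prednK // left_of_insert_old ?leq_pred //.
  by rewrite left_of_insert_max ?leq_pred ?ltnSn.
have old_letter (x : 'S_m.+1) : 0 < m ->
    letter x m.-1 = if left_of x m m.-1 then 2 else 0.
  by move=> m0; rewrite /letter prednK // ltnn.
have old k (x : 'S_m.+1) : x^-1%g k < m.+2 by apply: leqW.
case: c sm => /= sm.
- have [|x px sE] := IH s; first lia.
  exists (insert_max x ord_max).
    by apply: pell_insert_max => // k kE; have := ltn_ord k; rewrite kE ltnn.
  rewrite mkseq_insert_max ?last_letter => [|m0].
    by rewrite leqNgt ltn_ord -cats1 sE.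
  by rewrite prev_letter // old_letter // (leqNgt ord_max) ltn_ord.
- have [|x px sE] := IH s; first lia.
  exists (insert_max x (Ordinal (old (inord m) x))).
    apply: pell_insert_max => // k /val_inj ->.
    by left; rewrite permKV inordK.
  rewrite mkseq_insert_max ?last_letter => [|m0].
    by rewrite leqnn -cats1 sE.
  rewrite prev_letter // old_letter //; case: ifPn => // nl.
  rewrite ifF // leqNgt.
  by move: nl (left_of_total _ x m m.-1); rewrite /left_of /=; lia.
- case: m IH last_letter prev_letter old_letter old sm => [|m] IH ll pl ol old sm.
    by lia.
  have [|x px sE] := IH (rcons s Black); first by rewrite sash_len_rcons /=; lia.
  have nl : left_of x m.+1 m = false.
    move: sE; rewrite code_rcons cats1 mkseqS => /rcons_inj[_].
    by rewrite (ol x) //=; case: ifP.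
  have lt : left_of x m m.+1.
    by have := left_of_total _ x m m.+1; rewrite nl; lia.
  exists (insert_max x (Ordinal (old (inord m) x))).
    apply: pell_insert_max => // k /val_inj ->.
    by right; rewrite permKV inordK.
  rewrite !mkseqS ll (pl x) //= nl leqnn ifT; last exact: ltnW lt.
  move: sE; rewrite code_rcons cats1 mkseqS => /rcons_inj[-> _].
  rewrite -!cats1 -catA; congr (_ ++ _); apply/eq_in_map => i.
  by rewrite mem_iota => im; rewrite letter_insert_max //; lia.
Qed.

(** * The order and the covers *)

Lemma sash_leP m (s t : sash m) : sash_le s t <-> code_le (sval s) (sval t).
Proof.
have leP (x y : 'S_m.+1) : pell x ->
    weak_le x y = all2 leq (mkseq (letter x) m) (mkseq (letter y) m).
  move=> px; apply/(weak_le_letter _ _ _ px)/idP => [H|].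
    rewrite all2E !size_mkseq eqxx /=; apply/allP => -[a b].
    move/(nthP (0,0)) => [i]; rewrite size_zip !size_mkseq minnn => im.
    by rewrite nth_zip ?size_mkseq // !nth_mkseq // => -[<- <-]; apply: H.
  rewrite all2E !size_mkseq eqxx /= => /allP H i im.
  apply: (H (letter x i, letter y i)); apply/(nthP (0,0)); exists i.
    by rewrite size_zip !size_mkseq minnn.
  by rewrite nth_zip ?size_mkseq // !nth_mkseq.
split=> [[x [y [px py <- <- xy]]]|].
  by rewrite /code_le !code_sigma -leP.
have [x px sE] := pell_exists m _ (eqP (valP s)).
have [y py tE] := pell_exists m _ (eqP (valP t)).
rewrite /code_le sE tE -leP // => xy; exists x, y; split=> //.
  by apply/val_inj/code_inj; rewrite sE -code_sigma.
by apply/val_inj/code_inj; rewrite tE -code_sigma.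
Qed.

Theorem proposition2p9 (m : nat) (s t : sash m) :
  sash_cover s t <->
  (exists A B : seq tile,
     [\/ [/\ sval s = A ++ Black :: B, sval t = A ++ White :: B
           & ohead B <> Some White],
         sval s = A ++ [:: Black, White & B] /\ sval t = A ++ Rect :: B
       | sval s = A ++ Rect :: B /\ sval t = A ++ [:: White, White & B]]).
Proof.
change (sash_cover s t <-> step (sval s) (sval t)); split.
  case=> -[/sash_leP st neq] nobetween.
  have [/val_inj //|[u su ut]] := code_le_step _ _ st.
  have [cle ne] := step_lt _ _ su.
  have um : sash_len u == m.
    have := cle; rewrite /code_le all2E !size_code => /andP[/eqP<- _].
    exact: valP s.
  have [/code_inj<- //|/eqP ut_neq] := eqVneq (code u) (code (sval t)).
  case: nobetween; exists (exist _ u um); split; split.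
  - exact/sash_leP.
  - by move=> su_eq; apply: ne; rewrite su_eq.
  - exact/sash_leP.
  - by move=> ut_eq; apply: ut_neq; rewrite -ut_eq.
move=> st; have [le ne] := step_lt _ _ st.
split; first by split; [apply/sash_leP | move=> st_eq; apply: ne; rewrite st_eq].
case=> u [[/sash_leP su nsu] [/sash_leP ut nut]].
by have [/val_inj E|/val_inj E] := step_cover _ _ _ st su ut; [apply: nsu | apply: nut].
Qed.
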